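(* Let a line have constants $m,c_p>0$, $r,D_0,\epsilon,\sigma,T_a,q^s,k^c,k^{c,0}$ and constant squared current $\iota$, and let its temperature $T(\tau)$ on $[0,\Delta]$ satisfy the heat equation $$m c_p\frac{dT}{d\tau}=R(T)\,\iota+q^s-q^c(T)-q^r(T),\qquad q^r(T)=\pi D_0\epsilon\sigma\,(T^4-T_a^4),$$ under the assumptions: (i) $R(T)=r$ does not depend on $T$; (ii) the weather conditions are constant on $[0,\Delta]$, so the energy fluxes are functions of $T$ only; (iii) $q^c(T)=k^cT+k^{c,0}$. Then the heat equation can be reformulated as $$\frac{dT}{d\tau}=-K_4T^4-K_1T+K_0,$$ where $K_0=K_0'+r'\iota$, $r'=\frac{r}{mc_p}$, $K_1=\frac{k^c}{mc_p}$, $K_0'=\frac{\pi D_0\epsilon\sigma T_a^4+q^s-k^{c,0}}{mc_p}$ and $K_4=\frac{\pi D_0\epsilon\sigma}{mc_p}$. Moreover, when $K_4>0$ and $K_0>0$, the quartic polynomial $P(T):=T^4+\frac{K_1}{K_4}T-\frac{K_0}{K_4}$ has two distinct real roots, a positive one, denoted $s_1$, and a negative one, denoted $-s_2$. Furthermore, given an initial temperature $T_0$ at time $\tau=0$ with $T_0\neq s_1$, the solution of the ODE is given (implicitly, with time expressed as a function of temperature) by $$\tau(T)=\frac{1}{K_4}\Bigg[\frac{s_2-s_1}{g_1g_2}\log\frac{|T^2-pT+q|}{|T_0^2-pT_0+q|}-\frac{1}{s_1+s_2}\bigg(\frac{1}{g_1}\log\frac{|T-s_1|}{|T_0-s_1|}-\frac{1}{g_2}\log\frac{|T+s_2|}{|T_0+s_2|}\bigg)+\frac{4s_1s_2}{g_1g_2\sqrt{g_3}}\left(\arctan\frac{2T-p}{\sqrt{g_3}}-\arctan\frac{2T_0-p}{\sqrt{g_3}}\right)\Bigg],$$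 where $p=s_2-s_1$, $q=s_1^2-s_1s_2+s_2^2$, $g_1=3s_1^2-2s_1s_2+s_2^2$, $g_2=s_1^2-2s_1s_2+3s_2^2$ and $g_3=3s_1^2-2s_1s_2+3s_2^2$.
   Context: $T$ is the conductor temperature of a transmission line, in Kelvins (hence positive, including the initial temperature $T_0$), as a function of time $\tau\in[0,\Delta]$, $\Delta>0$. $m$ is the mass, $c_p$ the specific heat capacity, $r$ the resistivity, $D_0$ the diameter, $\epsilon$ the emissivity, $\sigma$ the Stefan--Boltzmann constant, $T_a$ the ambient temperature, $q^s$ the solar gain (independent of $T$), $q^c$ the convective loss, $q^r$ the radiative loss, and $\iota$ the squared current magnitude, assumed constant on $[0,\Delta]$. The statement is for one fixed line. *)

(* Defs.v *)
From HB Require Import structures.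
From mathcomp Require Import all_boot all_order all_algebra.
From mathcomp Require Import all_classical all_reals all_analysis.
Import Order.TTheory GRing.Theory Num.Theory.
Import numFieldNormedType.Exports.

Set Implicit Arguments.
Unset Strict Implicit.
Unset Printing Implicit Defensive.

Local Open Scope classical_set_scope.
Local Open Scope ring_scope.

(** [d] is the derivative at [x] of [f] restricted to [A]: for [A] a closed
    interval this is the two-sided derivative inside and the one-sided
    derivative at the endpoints. *)
Definition is_derive_within (R : realType) (A : set R) (f : R -> R)
    (x d : R) : Prop :=
  (f y - f x) / (y - x) @[y --> within A x^'] --> d.

Definition radiative_loss (R : realType) (D0 eps sigma Ta x : R) : R :=
  pi * D0 * eps * sigma * (x ^+ 4 - Ta ^+ 4).

(** The weather is a function of time with values in an arbitrary type [W] of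
    weather conditions; the ambient temperature, the solar gain and the
    convective loss depend on time only through it. *)
Definition heat_equation (R : realType) (W : Type)
    (m cp D0 eps sigma iota : R) (resistance : R -> R)
    (weather : R -> W) (ambient solar : W -> R) (convective : W -> R -> R)
    (Delta : R) (T : R -> R) : Prop :=
  forall t : R, 0 <= t <= Delta ->
  exists2 dT : R, is_derive_within `[0, Delta] T t dT &
    m * cp * dT =
      resistance (T t) * iota + solar (weather t)
      - convective (weather t) (T t)
      - radiative_loss D0 eps sigma (ambient (weather t)) (T t).

Definition reduced_ode (R : realType) (K4 K1 K0 Delta : R) (T : R -> R) : Prop :=
  forall t : R, 0 <= t <= Delta ->
  is_derive_within `[0, Delta] T t (- K4 * T t ^+ 4 - K1 * T t + K0).

Definition steady_state_poly (R : realType) (K4 K1 K0 : R) : {poly R} :=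
  'X^4 + (K1 / K4) *: 'X - (K0 / K4)%:P.

(** Since [ln 0 = 0] here, this is meaningful only when [x] and [T0] both differ
    from [s1] and [- s2]. *)
Definition time_of_temperature (R : realType) (K4 s1 s2 T0 x : R) : R :=
  let p := s2 - s1 in
  let q := s1 ^+ 2 - s1 * s2 + s2 ^+ 2 in
  let g1 := 3 * s1 ^+ 2 - 2 * s1 * s2 + s2 ^+ 2 in
  let g2 := s1 ^+ 2 - 2 * s1 * s2 + 3 * s2 ^+ 2 in
  let g3 := 3 * s1 ^+ 2 - 2 * s1 * s2 + 3 * s2 ^+ 2 in
  1 / K4 *
  ((s2 - s1) / (g1 * g2)
     * ln (`|x ^+ 2 - p * x + q| / `|T0 ^+ 2 - p * T0 + q|)
   - 1 / (s1 + s2)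
     * (1 / g1 * ln (`|x - s1| / `|T0 - s1|)
        - 1 / g2 * ln (`|x + s2| / `|T0 + s2|))
   + 4 * s1 * s2 / (g1 * g2 * Num.sqrt g3)
     * (atan ((2 * x - p) / Num.sqrt g3) - atan ((2 * T0 - p) / Num.sqrt g3))).

(* Main.v *)
Require Import Defs.
From HB Require Import structures.
From mathcomp Require Import all_boot all_order all_algebra.
From mathcomp Require Import all_classical all_reals all_analysis.
From mathcomp Require Import ring lra.
Import Order.TTheory GRing.Theory Num.Theory.
Import numFieldNormedType.Exports.

Set Implicit Arguments.
Unset Strict Implicit.
Unset Printing Implicit Defensive.

Local Open Scope classical_set_scope.
Local Open Scope ring_scope.

(** Dividing the heat equation by [m * cp] gives the reduced equation.  When
    [K4] and [K0] are positive it reads [T' = - K4 * P(T)], where [P] is the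
    monic quartic [x^4 + a x - b] with [a = K1 / K4] and [b = K0 / K4 > 0].

    Since [P(0) < 0] and [P] is positive far out, the intermediate value theorem
    gives [P] a positive root [s1]; the same applied to [P(- x)] gives a
    negative root [- s2].  The two root equations determine [a] and [b] as
    polynomials in [s1] and [s2], whence
      [P(x) = (x - s1) (x + s2) (x^2 - p x + q)],
    and the last factor is a sum of squares without real root.  Thus uniqueness
    of the two roots comes for free from their existence
    ([quartic_factorization], [cofactor_quadratic_gt0]).

    Away from the roots, the explicit function [time_of_temperature] is a
    primitive of [x |-> - 1 / (K4 * P(x))]: this is the partial fraction
    decomposition along the factorization
    ([is_derive_time_of_temperature]).  Writing [F] for this primitive, the
    equation is separable, and solving it amounts to the implicit equation
    [F (T t) = t]:

    - if [T] is a solution, then [F o T] has derivative 1 and vanishes at 0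
      ([time_of_separable_solution]).  This needs [T] to avoid [s1]
      on the whole interval, which holds because [T - s1] solves a linear
      homogeneous equation with bounded coefficient and so cannot reach 0 from a
      nonzero initial value ([linear_ode_neq0]);

    - conversely, if [T] is continuous with [F (T t) = t], the difference
      quotients of [T] are the inverses of those of [F], so that [T] has
      derivative [- K4 * P(T)], one-sided at the endpoints
      ([is_derive_within_inverse]). *)

(** * Derivatives relative to a set *)

Section DeriveWithin.
Context {R : realType}.
Implicit Types (A : set R) (f : R -> R) (x d : R).

Lemma is_derive_difference_quotient f x d :
  is_derive x 1 f d <-> (f y - f x) / (y - x) @[y --> x^'] --> d.
Proof.
(* the two limits correspond through the change of variable y = x + h *)
have -> : (f y - f x) / (y - x) @[y --> x^'] =
    (fun h => h^-1 *: ((f \o shift x) (h *: 1) - f x)) @ 0^'.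
  rewrite eqEsubset; split => B [e /= e0 eB]; exists e => //= z /= xz zx.
    rewrite /= [_%:A]mulr1 [_ *: _]mulrC -{2}[z](addrK x).
    apply: eB; last by rewrite -subr_eq0 addrK.
    by rewrite /ball_ /= opprD addrCA subrr addr0 -sub0r.
  have := eB (z - x).
  rewrite /= /ball_ /= sub0r opprB [_%:A]mulr1 addrNK.
  by rewrite [_ *: _]mulrC; apply => //; rewrite subr_eq0.
split=> [[df <-]|fd].
  exact: df.
by apply: DeriveDef; [apply/cvg_ex; exists d | exact: cvg_lim fd].
Qed.

(** At an interior point, restricting to [A] does not change the punctured
    neighborhoods. *)
Lemma is_derive_within_interior A f x d :
  nbhs x A -> is_derive_within A f x d -> is_derive x 1 f d.
Proof.
move=> xA fd; apply/is_derive_difference_quotient; apply: cvg_trans fd.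
apply: cvg_app => B AB.
have {}AB : \forall y \near x^', A y -> B y by [].
by apply: filterS2 (nbhs_dnbhs xA) AB => y Ay; apply.
Qed.

(** Multiply the difference quotient by [y - x], which tends to 0. *)
Lemma is_derive_within_cvg A f x d :
  is_derive_within A f x d -> f @ within A x^' --> f x.
Proof.
move=> fd.
have xx : y - x @[y --> within A x^'] --> 0.
  rewrite -(subrr x); apply: cvgB; last exact: cvg_cst.
  exact: cvg_trans (cvg_within A (F := x^')) (@nbhs_dnbhs _ x).
have fx : (f y - f x) / (y - x) * (y - x) + f x @[y --> within A x^'] --> f x.
  rewrite -[X in _ --> X]add0r -(mulr0 d).
  by apply: cvgD; [exact: cvgM | exact: cvg_cst].
apply: cvg_trans fx.
apply: near_eq_cvg; rewrite near_withinE; near=> y => _.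
by rewrite /= divfK ?subrK// subr_eq0; near: y; exact: nbhs_dnbhs_neq.
Unshelve. all: by end_near. Qed.

Lemma is_derive_within_continuous A f (df : R -> R) :
  (forall x, A x -> is_derive_within A f x (df x)) -> {within A, continuous f}.
Proof.
move=> fd; apply/subspace_continuousP => x Ax B fxB.
have xB : \forall y \near x^', A y -> B (f y).
  exact: is_derive_within_cvg (fd x Ax) _ fxB.
change (nbhs x [set y | A y -> B (f y)]); rewrite dnbhsE; split=> //.
by apply/principal_filterP => _; exact: nbhs_singleton fxB.
Qed.

End DeriveWithin.

(** * Scalar equations: separation of variables, linear equations *)

Section ScalarEquations.
Context {R : realType}.
Implicit Types (A : set R) (F T u c : R -> R) (x d Delta : R).

(** Derivative of a local right inverse, one-sided if need be: with
    [F (T y) = y], the difference quotient of [T] at [x] is the inverse of the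
    difference quotient of [F] between [T y] and [T x]. *)
Lemma is_derive_within_inverse A F T x d :
  d != 0 -> is_derive (T x) 1 F d^-1 ->
  A x -> T @ within A (nbhs x) --> T x -> (forall y, A y -> F (T y) = y) ->
  is_derive_within A T x d.
Proof.
move=> d0 dF Ax cT FT.
(* T y differs from T x for y != x in A, because F maps them to y and x *)
have TyTx : T @ within A x^' --> (T x)^'.
  move=> B TxB.
  have Bx : \forall y \near within A (nbhs x), T y != T x -> B (T y).
    exact: (cT [set z | z != T x -> B z]).
  change (\forall y \near x^', A y -> B (T y)).
  change (\forall y \near x, A y -> T y != T x -> B (T y)) in Bx.
  change (\forall y \near x, y != x -> A y -> B (T y)).
  apply: filterS Bx => y TB yx Ay; apply: TB => //.
  by apply: contra_neq yx => TT; rewrite -(FT _ Ay) TT FT.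
have /is_derive_difference_quotient FTx := dF.
have dT : ((F (T y) - F (T x)) / (T y - T x))^-1 @[y --> within A x^'] --> d.
  rewrite -[d]invrK; apply: cvgV; first exact: invr_neq0.
  exact: cvg_comp TyTx FTx.
apply: cvg_trans dT.
apply: near_eq_cvg; rewrite near_withinE; near=> y => Ay /=.
by rewrite invf_div !FT.
Unshelve. all: by end_near. Qed.

Lemma is_derive_within_itv_interior Delta T x d :
  0 < x < Delta -> is_derive_within `[0, Delta] T x d -> is_derive x 1 T d.
Proof.
move=> x0D; apply: is_derive_within_interior.
have : \forall y \near x, y \in `]0, Delta[%R.
  by apply: near_in_itvoo; rewrite in_itv.
by apply: filterS => y /=; rewrite !in_itv /= => /andP[/ltW -> /ltW ->].
Qed.

(** Separation of variables for [T' = f(T)]: if [F] is a primitive of [1 / f]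
    along [T], the chain rule gives [(F o T)' = 1]. *)
Lemma time_of_separable_solution Delta F T (f : R -> R) :
  (forall t, 0 <= t <= Delta -> is_derive_within `[0, Delta] T t (f (T t))) ->
  (forall t, 0 <= t <= Delta -> f (T t) != 0) ->
  (forall t, 0 <= t <= Delta -> is_derive (T t) 1 F (f (T t))^-1) ->
  forall t, 0 <= t <= Delta -> F (T t) - F (T 0) = t.
Proof.
move=> dT f0 dF t /andP[t0 tD].
have sub s : 0 <= s <= t -> 0 <= s <= Delta.
  by move=> /andP[-> /le_trans ->].
have subI : `[0, t] `<=` `[0, Delta].
  by move=> s; rewrite /= !in_itv; exact: sub.
have cT : {within `[0, Delta], continuous T}.
  apply: (@is_derive_within_continuous _ _ _ (f \o T)) => s.
  by rewrite /= in_itv; exact: dT.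
have cFT : {within `[0, t], continuous (F \o T)}.
  apply/subspace_continuousP => s; rewrite /= in_itv /= => s0t.
  have s0D := sub _ s0t.
  apply: continuous_cvg.
    apply: differentiable_continuous; apply/derivable1_diffP.
    by have [] := dF _ s0D.
  have /subspace_continuousP := continuous_subspaceW subI cT; apply.
  by rewrite /= in_itv.
have dFT s : s \in `]0, t[%R -> is_derive s 1 (F \o T) 1.
  rewrite in_itv /= => /andP[s0 st].
  have s0D : 0 <= s <= Delta by apply: sub; rewrite !ltW.
  apply: is_derive_eq (mulVf (f0 _ s0D)).
  apply: is_derive1_comp; first exact: dF.
  apply: (@is_derive_within_itv_interior Delta); last exact: dT.
  by rewrite s0 (lt_le_trans st).
have [_ _] := MVT_segment t0 dFT cFT.
by rewrite mul1r subr0.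
Qed.

(** Gronwall argument: where [`|c| <= C], the function [u^2 * exp (2 C t)] has
    derivative [2 (c + C) u^2 * exp (2 C t) >= 0], so it stays above its initial
    value. *)
Lemma linear_ode_neq0 Delta c u (C : R) :
  (forall t, 0 <= t <= Delta -> is_derive_within `[0, Delta] u t (c t * u t)) ->
  (forall t, 0 <= t <= Delta -> `|c t| <= C) ->
  u 0 != 0 -> forall t, 0 <= t <= Delta -> u t != 0.
Proof.
move=> du cC u0 t /andP[t0 tD].
have sub s : 0 <= s <= t -> 0 <= s <= Delta.
  by move=> /andP[-> /le_trans ->].
have subI : `[0, t] `<=` `[0, Delta].
  by move=> s; rewrite /= !in_itv; exact: sub.
have cu : {within `[0, Delta], continuous u}.
  apply: (@is_derive_within_continuous _ _ _ (fun s => c s * u s)) => s.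
  by rewrite /= in_itv; exact: du.
pose g s := u s * u s * expR (2 * C * s).
pose dg s := 2 * (c s + C) * (u s) ^+ 2 * expR (2 * C * s).
have dE (s : R) :
    is_derive s 1 (fun s => expR (2 * C * s)) (expR (2 * C * s) * (2 * C)).
  apply: is_derive1_comp.
  exact: is_derive_eq (is_deriveZ (2 * C) (is_derive_id s 1)) (mulr1 _).
have cg : {within `[0, t], continuous g}.
  apply/subspace_continuousP => s; rewrite /= in_itv /= => s0t.
  have s0D := sub _ s0t.
  have us : u @ within `[0, t] (nbhs s) --> u s.
    have /subspace_continuousP := continuous_subspaceW subI cu; apply.
    by rewrite /= in_itv.
  apply: cvgM; first exact: cvgM.
  have /derivable1_diffP/differentiable_continuous cE :=
    @ex_derive _ _ _ _ _ _ _ (dE s).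
  exact: cvg_within_filter cE.
have dgs s : s \in `]0, t[%R -> is_derive s 1 g (dg s).
  rewrite in_itv /= => /andP[s0 st].
  have s0D : 0 <= s <= Delta by apply: sub; rewrite !ltW.
  have dus : is_derive s 1 u (c s * u s).
    apply: (@is_derive_within_itv_interior Delta); last exact: du.
    by rewrite s0 (lt_le_trans st).
  apply: is_derive_eq (is_deriveM (is_deriveM dus dus) (dE s)) _.
  rewrite /dg /GRing.scale /= (_ : (u * u) s = u s * u s) //; ring.
have [s] := MVT_segment t0 dgs cg; rewrite in_itv /= subr0 => /sub s0D gt.
have : 0 < g t.
  rewrite -(subrK (g 0) (g t)) gt ltr_wpDl //.
    apply: mulr_ge0 => //; rewrite /dg.
    rewrite mulr_ge0 ?expR_ge0// mulr_ge0 ?sqr_ge0//.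
    by rewrite mulr_ge0//; move: (cC _ s0D); rewrite ler_norml; lra.
  by rewrite /g mulr_gt0 ?expR_gt0 // -expr2 exprn_even_gt0.
by apply: contraTneq => ut; rewrite /g ut !mul0r ltxx.
Qed.

End ScalarEquations.

(** * The steady-state quartic and the primitive of its inverse *)

Section Quartic.
Context {R : realType}.
Implicit Types (x a b : R).

Lemma root_steady_state_poly (K4 K1 K0 x : R) :
  root (steady_state_poly K4 K1 K0) x <-> x ^+ 4 + K1 / K4 * x - K0 / K4 = 0.
Proof.
by rewrite rootE /steady_state_poly !hornerE; split=> [/eqP|->].
Qed.

(** The witness [M] below is a point where the quartic is nonnegative: as
    [M >= 1], [M^4 >= M^2 = M + `|a| M + b M] absorbs [- `|a| M] and [b]. *)
Lemma quartic_pos_root a b : 0 < b -> exists2 s, 0 < s & s ^+ 4 + a * s = b.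
Proof.
move=> b0; pose P : {poly R} := 'X^4 + a *: 'X - b%:P.
have PE x : P.[x] = x ^+ 4 + a * x - b by rewrite /P !hornerE.
pose M := 1 + `|a| + b.
have M0 : 0 <= M by rewrite /M; have := normr_ge0 a; lra.
have [|s /andP[s0 _]] := @poly_ivt R P 0 M M0.
  rewrite !PE [0 ^+ 4]exprS mul0r mulr0; apply/andP; split; first by lra.
  have aM : - `|a| * M <= a * M.
    by apply: ler_wpM2r => //; rewrite lerNl -normrN ler_norm.
  have M1 : 1 <= M by rewrite /M; have := normr_ge0 a; lra.
  have M24 : M ^+ 2 <= M ^+ 4 by apply: ler_weXn2l.
  have bM : b <= b * M by rewrite ler_peMr// ltW.
  have : M ^+ 2 = (1 + `|a| + b) * M by rewrite expr2.
  nra.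
rewrite rootE PE => /eqP Ps; exists s; last by lra.
rewrite lt_neqAle s0 andbT eq_sym; apply/eqP => s0'.
by move: Ps; rewrite s0' [0 ^+ 4]exprS mul0r mulr0; lra.
Qed.

(** The quotient of the quartic by [(x - s1) (x + s2)]; with [p = s2 - s1] and
    [q = s1^2 - s1 s2 + s2^2] it is [x^2 - p x + q]. *)
Definition cofactor_quadratic (s1 s2 : R) x :=
  x ^+ 2 - (s2 - s1) * x + (s1 ^+ 2 - s1 * s2 + s2 ^+ 2).

Lemma cofactor_quadratic_gt0 (s1 s2 : R) x :
  0 < s1 -> 0 < s2 -> 0 < cofactor_quadratic s1 s2 x.
Proof.
move=> s10 s20; rewrite /cofactor_quadratic.
(* completing the square in x, then in s1 - s2 *)
have -> : x ^+ 2 - (s2 - s1) * x + (s1 ^+ 2 - s1 * s2 + s2 ^+ 2) =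
    (x - (s2 - s1) / 2) ^+ 2 + (s1 - s2) ^+ 2 / 4 + s1 ^+ 2 / 2 + s2 ^+ 2 / 2.
  by field.
have := sqr_ge0 (x - (s2 - s1) / 2); have := sqr_ge0 (s1 - s2).
have : 0 < s1 ^+ 2 by rewrite exprn_gt0.
have : 0 < s2 ^+ 2 by rewrite exprn_gt0.
lra.
Qed.

(** Subtracting the two root equations and dividing by [s1 + s2] yields
    [a = (s2 - s1) (s1^2 + s2^2)]; what remains is a polynomial identity. *)
Lemma quartic_factorization (s1 s2 : R) a b x :
  0 < s1 -> 0 < s2 -> s1 ^+ 4 + a * s1 = b -> s2 ^+ 4 - a * s2 = b ->
  x ^+ 4 + a * x - b = (x - s1) * (x + s2) * cofactor_quadratic s1 s2 x.
Proof.
move=> s10 s20 e1 e2.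
have aE : a = (s2 - s1) * (s1 ^+ 2 + s2 ^+ 2).
  have s0 : s1 + s2 != 0 by apply: lt0r_neq0; lra.
  apply: (mulIf s0).
  by rewrite (_ : a * (s1 + s2) = s2 ^+ 4 - s1 ^+ 4); [ring|lra].
by rewrite -e1 aE /cofactor_quadratic; ring.
Qed.

Lemma is_derive_ln_norm x : x != 0 -> is_derive x 1 (fun y : R => ln `|y|) x^-1.
Proof.
have pos (z : R) : 0 < z -> is_derive z 1 (fun y : R => ln `|y|) z^-1.
  move=> z0; apply: near_eq_is_derive (is_derive1_ln z0).
  by apply: filterS (lt_nbhsr z0) => y y0; rewrite gtr0_norm.
rewrite neq_lt => /orP[x0|/pos//].
have -> : (fun y : R => ln `|y|) = (fun y => ln `|y|) \o -%R.
  by apply/funext => y /=; rewrite normrN.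
have -> : x^-1 = (- x)^-1 * -1 by rewrite invrN mulrN1 opprK.
apply: is_derive1_comp; first by apply: pos; rewrite oppr_gt0.
Qed.

Lemma is_derive_ln_norm_ratio (g : R -> R) x dg (c : R) :
  g x != 0 -> c != 0 -> is_derive x 1 g dg ->
  is_derive x 1 (fun y => ln (`|g y| / `|c|)) ((g x)^-1 * dg).
Proof.
move=> gx0 c0 dgx.
have -> : (fun y => ln (`|g y| / `|c|)) =
    (fun y => ln `|y|) \o (fun y => c^-1 * g y).
  by apply/funext => y /=; rewrite normrM normfV mulrC.
have -> : (g x)^-1 * dg = (c^-1 * g x)^-1 * (c^-1 * dg).
  by field; rewrite gx0 c0.
have dcg := is_deriveZ c^-1 dgx.
apply: is_derive1_comp.
by apply: is_derive_ln_norm; rewrite mulf_neq0 ?invr_neq0.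
Qed.

(** Partial fractions of [1 / ((x - s1) (x + s2) Q(x))], with [Q] the cofactor
    quadratic: the residues at [s1] and [- s2] have denominators
    [(s1 + s2) g1] and [(s1 + s2) g2], since [g1 = Q(s1)] and [g2 = Q(- s2)];
    the part over [Q] integrates to a logarithm and an arctangent, where [- g3]
    is the discriminant of [Q]. *)
Lemma is_derive_time_of_temperature (K4 s1 s2 T0 x : R) :
  K4 != 0 -> 0 < s1 -> 0 < s2 ->
  T0 != s1 -> T0 != - s2 -> x != s1 -> x != - s2 ->
  is_derive x 1 (time_of_temperature K4 s1 s2 T0)
    (- K4 * ((x - s1) * (x + s2) * cofactor_quadratic s1 s2 x))^-1.
Proof.
move=> K40 s10 s20 T01 T02 x1 x2.
have Q0 y := lt0r_neq0 (cofactor_quadratic_gt0 y s10 s20).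
rewrite /time_of_temperature.
set g1 := 3 * _ - _ + _; set g2 := _ - _ + 3 * s2 ^+ 2.
set g3 := _ + 3 * s2 ^+ 2; set r := Num.sqrt g3.
have s10' : 0 < s1 ^+ 2 by rewrite exprn_gt0.
have s20' : 0 < s2 ^+ 2 by rewrite exprn_gt0.
have := sqr_ge0 (s1 - s2); rewrite sqrrB => s12.
have g10 : g1 != 0 by apply: lt0r_neq0; rewrite /g1; lra.
have g20 : g2 != 0 by apply: lt0r_neq0; rewrite /g2; lra.
have g30 : 0 < g3 by rewrite /g3; lra.
have r0 : r != 0 by rewrite lt0r_neq0// sqrtr_gt0.
have r2 : r ^+ 2 = g3 by rewrite sqr_sqrtr// ltW.
have dQ : is_derive x 1
    (fun y => y ^+ 2 - (s2 - s1) * y + (s1 ^+ 2 - s1 * s2 + s2 ^+ 2))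
    (2 * x - (s2 - s1)).
  by apply: is_derive_eq; rewrite /GRing.scale /=; ring.
have d1 : is_derive x 1 (fun y => y - s1) 1.
  by apply: is_derive_eq; rewrite subr0.
have d2 : is_derive x 1 (fun y => y + s2) 1.
  by apply: is_derive_eq; rewrite addr0.
have d3 : is_derive x 1 (fun y => (2 * y - (s2 - s1)) / r) (2 / r).
  by apply: is_derive_eq; rewrite /GRing.scale /=; ring.
have dA := is_derive1_comp (is_derive1_atan _) d3.
have x1' : x - s1 != 0 by rewrite subr_eq0.
have x2' : x + s2 != 0 by rewrite addr_eq0.
have T1' : T0 - s1 != 0 by rewrite subr_eq0.
have T2' : T0 + s2 != 0 by rewrite addr_eq0.
have L1 := @is_derive_ln_norm_ratio (fun y => y - s1) _ _ _ x1' T1' d1.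
have L2 := @is_derive_ln_norm_ratio (fun y => y + s2) _ _ _ x2' T2' d2.
have LQ :=
  @is_derive_ln_norm_ratio (cofactor_quadratic s1 s2) _ _ _ (Q0 x) (Q0 T0) dQ.
have D := is_deriveZ (1 / K4) (is_deriveD (is_deriveB
  (is_deriveZ ((s2 - s1) / (g1 * g2)) LQ)
  (is_deriveZ (1 / (s1 + s2))
     (is_deriveB (is_deriveZ (1 / g1) L1) (is_deriveZ (1 / g2) L2))))
  (is_deriveZ (4 * s1 * s2 / (g1 * g2 * r))
     (is_deriveB dA (is_derive_cst (atan ((2 * T0 - (s2 - s1)) / r)) x 1)))).
refine (is_derive_eq D _) => {D L1 L2 LQ dA d1 d2 d3 dQ}.
rewrite /GRing.scale /=.
rewrite subr0 !mulr1.
(* by 4 Q(x) = (2 x - p)^2 + g3, the square root disappears from the derivative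
   of the arctangent term *)
have -> : (1 + ((2 * x - (s2 - s1)) / r) ^+ 2)^-1 * (2 / r) =
    r / (2 * cofactor_quadratic s1 s2 x).
  have -> : 1 + ((2 * x - (s2 - s1)) / r) ^+ 2 =
      4 * cofactor_quadratic s1 s2 x / r ^+ 2.
    rewrite [in RHS]r2 expr_div_n r2.
    rewrite -[X in X + _](divff (lt0r_neq0 g30)) -mulrDl.
    by congr (_ / _); rewrite /g3 /cofactor_quadratic; ring.
  by field; rewrite r0 Q0.
have s120 : s1 + s2 != 0 by apply: lt0r_neq0; lra.
have Qx := Q0 x; rewrite /cofactor_quadratic in Qx *.
rewrite {}/g1 {}/g2 in g10 g20 *.
by field; rewrite Qx x2' x1' K40 r0 g20 g10 s120.
Qed.

End Quartic.

(** * The reduced equation *)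

Section ReducedEquation.
Context {R : realType}.

Lemma time_of_temperature_initial (K4 s1 s2 T0 : R) :
  0 < s1 -> 0 < s2 -> T0 != s1 -> T0 != - s2 ->
  time_of_temperature K4 s1 s2 T0 T0 = 0.
Proof.
move=> s10 s20 T01 T02; rewrite /time_of_temperature.
rewrite -/(cofactor_quadratic s1 s2 T0) !divff ?normr_eq0 ?subr_eq0 ?addr_eq0//.
  by rewrite ln1 !mulr0 !subrr !mulr0 subr0 addr0 mulr0.
by rewrite -addr_eq0 lt0r_neq0 ?cofactor_quadratic_gt0.
Qed.

Lemma reduced_ode_continuous (K4 K1 K0 Delta : R) (T : R -> R) :
  reduced_ode K4 K1 K0 Delta T -> {within `[0, Delta], continuous T}.
Proof.
move=> ode; apply: (is_derive_within_continuous
  (df := fun t => - K4 * T t ^+ 4 - K1 * T t + K0)) => t.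
by rewrite /= in_itv; exact: ode.
Qed.

(** Along a solution [T], the difference [u = T - s1] satisfies [u' = G(T) u],
    with [G] the product of the other factors of the right-hand side; [G o T] is
    bounded, being continuous on a segment. *)
Lemma reduced_ode_avoids_steady_state (K4 K1 K0 s1 s2 Delta : R) (T : R -> R) :
  0 < Delta ->
  (forall x, - K4 * x ^+ 4 - K1 * x + K0 =
     - K4 * ((x - s1) * (x + s2) * cofactor_quadratic s1 s2 x)) ->
  reduced_ode K4 K1 K0 Delta T -> T 0 != s1 ->
  forall t, 0 <= t <= Delta -> T t != s1.
Proof.
move=> Delta_gt0 rhs_factorization ode T0 t t0D.
pose G x := - K4 * ((x + s2) * cofactor_quadratic s1 s2 x).
have cG : continuous G.
  move=> x; apply/differentiable_continuous/derivable1_diffP.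
  by apply: ex_derive.
have cGT : {within `[0, Delta], continuous ((fun x : R => `|G x| : R) \o T)}.
  apply/subspace_continuousP => s s0D; apply: continuous_cvg.
    by apply: cvg_norm; exact: cG.
  by have /subspace_continuousP := reduced_ode_continuous ode; apply.
have [s _ GT] := EVT_max (ltW Delta_gt0) cGT.
rewrite -subr_eq0.
apply: (@linear_ode_neq0 _ Delta (G \o T) (fun t => T t - s1) `|G (T s)|) => //.
- move=> z z0D; have := ode z z0D; rewrite /is_derive_within rhs_factorization.
  have -> : - K4 * ((T z - s1) * (T z + s2) * cofactor_quadratic s1 s2 (T z)) =
    (G \o T) z * (T z - s1) by rewrite /G /=; ring.
  by under [in X in _ -> X]eq_fun do rewrite opprB addrA subrK.
- by rewrite subr_eq0.
Qed.

(** Temperatures are positive, so the root [- s2] is never met; this is why only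
    [s1] has to be excluded. *)
Lemma reduced_ode_iff_time (K4 K1 K0 s1 s2 Delta : R) (T : R -> R) :
  0 < K4 -> 0 < s1 -> 0 < s2 -> 0 < Delta ->
  (forall x, - K4 * x ^+ 4 - K1 * x + K0 =
     - K4 * ((x - s1) * (x + s2) * cofactor_quadratic s1 s2 x)) ->
  (forall t, 0 <= t <= Delta -> 0 < T t) -> T 0 != s1 ->
  reduced_ode K4 K1 K0 Delta T <->
  {within `[0, Delta], continuous T} /\
  (forall t, 0 <= t <= Delta ->
     T t <> s1 /\ t = time_of_temperature K4 s1 s2 (T 0) (T t)).
Proof.
move=> K4_gt0 s1_gt0 s2_gt0 Delta_gt0 rhs_factorization T_gt0 T0s1.
have Ts2 t : 0 <= t <= Delta -> T t != - s2.
  by move=> /T_gt0 Tt; rewrite gt_eqF// (lt_trans _ Tt)// oppr_lt0.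
have z0D : 0 <= (0 : R) <= Delta by rewrite lexx ltW.
have dF t : 0 <= t <= Delta -> T t != s1 ->
    is_derive (T t) 1 (time_of_temperature K4 s1 s2 (T 0))
      (- K4 * T t ^+ 4 - K1 * T t + K0)^-1.
  move=> t0D Tt; rewrite rhs_factorization.
  apply: is_derive_time_of_temperature => //; [exact: lt0r_neq0|exact: Ts2|].
  exact: Ts2.
have rhs0 t : 0 <= t <= Delta -> T t != s1 ->
    - K4 * T t ^+ 4 - K1 * T t + K0 != 0.
  move=> t0D Tt; rewrite rhs_factorization mulNr oppr_eq0.
  rewrite !mulf_neq0 ?subr_eq0//.
  - exact: lt0r_neq0.
  - by rewrite addr_eq0 Ts2.
  - exact: lt0r_neq0 (cofactor_quadratic_gt0 _ s1_gt0 s2_gt0).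
split=> [ode|[cT FT] t t0D].
  have Ts1 :=
    reduced_ode_avoids_steady_state Delta_gt0 rhs_factorization ode T0s1.
  split; first exact: reduced_ode_continuous ode.
  move=> t t0D; split; first exact/eqP/Ts1.
  rewrite -[LHS](time_of_separable_solution (T := T)
    (f := fun x => - K4 * x ^+ 4 - K1 * x + K0) ode _ _ t0D
    (F := time_of_temperature K4 s1 s2 (T 0))).
  - by rewrite time_of_temperature_initial ?subr0//; exact: Ts2.
  - by move=> s s0D; apply: rhs0 => //; exact: Ts1.
  - by move=> s s0D; apply: dF => //; exact: Ts1.
have Ts1 : T t != s1 by apply/eqP; have [] := FT t t0D.
apply: (is_derive_within_inverse (rhs0 _ t0D Ts1) (dF _ t0D Ts1)).
- by rewrite /= in_itv.
- by have /subspace_continuousP := cT; apply; rewrite /= in_itv.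
- by move=> y; rewrite /= in_itv => /FT[].
Qed.

End ReducedEquation.

Theorem theorem5 (R : realType)
    (Delta m cp r D0 eps sigma Ta qs kc kc0 iota : R)
    (resistance : R -> R)
    (W : Type) (weather : R -> W) (w : W)
    (ambient solar : W -> R) (convective : W -> R -> R)
    (Delta_gt0 : 0 < Delta) (m_gt0 : 0 < m) (cp_gt0 : 0 < cp)
    (resistance_cst : forall x : R, 0 < x -> resistance x = r)
    (weather_cst : forall t : R, 0 <= t <= Delta -> weather t = w)
    (ambientE : ambient w = Ta) (solarE : solar w = qs)
    (convectiveE : forall x : R, 0 < x -> convective w x = kc * x + kc0) :
  let K0' := (pi * D0 * eps * sigma * Ta ^+ 4 + qs - kc0) / (m * cp) in
  let r' := r / (m * cp) in
  let K0 := K0' + r' * iota in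
  let K1 := kc / (m * cp) in
  let K4 := pi * D0 * eps * sigma / (m * cp) in
  (forall T : R -> R, (forall t : R, 0 <= t <= Delta -> 0 < T t) ->
     heat_equation m cp D0 eps sigma iota resistance weather ambient solar
       convective Delta T
     <-> reduced_ode K4 K1 K0 Delta T)
  /\
  (0 < K4 -> 0 < K0 ->
   exists s1 s2 : R,
     [/\ 0 < s1, 0 < s2,
         (forall x : R,
            root (steady_state_poly K4 K1 K0) x <-> x = s1 \/ x = - s2)
       & forall (T0 : R) (T : R -> R),
           (forall t : R, 0 <= t <= Delta -> 0 < T t) ->
           T 0 = T0 -> T0 <> s1 ->
           reduced_ode K4 K1 K0 Delta T
           <-> {within `[0, Delta], continuous T} /\
               (forall t : R, 0 <= t <= Delta ->
                  T t <> s1 /\ t = time_of_temperature K4 s1 s2 T0 (T t))]).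
Proof.
move=> K0' r' K0 K1 K4; split.
  move=> T T0; have mcp0 : m * cp != 0 by rewrite mulf_neq0 ?lt0r_neq0.
  have fluxE t : 0 <= t <= Delta ->
      resistance (T t) * iota + solar (weather t) - convective (weather t) (T t)
      - radiative_loss D0 eps sigma (ambient (weather t)) (T t) =
      m * cp * (- K4 * T t ^+ 4 - K1 * T t + K0).
    move=> t0D; rewrite weather_cst// ambientE solarE convectiveE ?T0//.
    rewrite resistance_cst ?T0// /radiative_loss /K0 /K1 /K4 /K0' /r'.
    by field; rewrite !lt0r_neq0.
  split=> H t t0D.
    have [dT dTt] := H t t0D; rewrite fluxE// => /(mulfI mcp0) <-.
    exact: dTt.
  by exists (- K4 * T t ^+ 4 - K1 * T t + K0); [exact: H|rewrite fluxE].
move=> K4_gt0 K0_gt0.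
have b0 : 0 < K0 / K4 by rewrite divr_gt0.
have [s1 s10 e1] := quartic_pos_root (K1 / K4) b0.
(* - s2 is a root of x^4 + a x - b when s2 is one of x^4 - a x - b *)
have [s2 s20] := quartic_pos_root (- (K1 / K4)) b0; rewrite mulNr => e2.
have PE x := quartic_factorization x s10 s20 e1 e2.
exists s1, s2; split=> //.
  move=> x; rewrite root_steady_state_poly PE; split.
    move=> /eqP; rewrite !mulf_eq0.
    rewrite (gt_eqF (cofactor_quadratic_gt0 x s10 s20)) orbF.
    by rewrite subr_eq0 addr_eq0 => /orP[/eqP|/eqP]; [left|right].
  by case=> ->; rewrite ?subrr ?addNr ?mul0r// mulr0 mul0r.
move=> T0 T T_gt0 <- /eqP T0s1; apply: reduced_ode_iff_time => // x.
by rewrite -PE; field; exact: lt0r_neq0.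
Qed.
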